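(* Let $B$ be a brace (i.e. a skew brace whose additive group is abelian). If $B$ is i-noetherian and soluble, then $B$ is finitely generated (as a skew brace).
   Context: A skew brace is a set $B$ with two group operations $+$ and $\cdot$ (the latter written by juxtaposition; $+$ need not be commutative) such that $a(b+c)=ab-a+ac$ for all $a,b,c\in B$; both groups have the same identity, denoted $0$. A brace is a skew brace with $(B,+)$ abelian. For $a,b\in B$ put $\lambda_a(b)=-a+ab$ and $a\ast b=-a+ab-b$. A subbrace of $B$ is a subset that is a subgroup of both $(B,+)$ and $(B,\cdot)$. An ideal is a subbrace $I$ with $(I,+)\unlhd(B,+)$, $(I,\cdot)\unlhd(B,\cdot)$ and $\lambda_a(I)\subseteq I$ for all $a\in B$; then $B/I$ is a skew brace. $B$ is finitely generated if there is a finite subset $X\subseteq B$ such that $B$ is the only subbrace of $B$ containing $X$. $B$ is i-noetherian if it satisfies the maximal condition (ascending chain condition) on ideals. A skew brace $A$ is abelian if $ab=ba=a+b=b+a$ for all $a,b\in A$. $B$ is soluble if there is a finite series of ideals of $B$, $0=I_0\leq I_1\leq\cdots\leq I_n=B$, such that $I_j/I_{j-1}$ is an abelian skew brace for every $1\le j\le n$. *)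

(* Defs.v *)
From HB Require Import structures.
From mathcomp Require Import all_boot.
From mathcomp Require Import boolp classical_sets functions cardinality.

Set Implicit Arguments.
Unset Strict Implicit.
Unset Printing Implicit Defensive.

Declare Scope brace_scope.
Delimit Scope brace_scope with B.

Local Open Scope classical_set_scope.
Local Open Scope group_scope.
Local Open Scope brace_scope.

(* MathComp's additive groups are commutative, so the additive group of a     *)
(* skew brace is given by operations of its own; the multiplicative one is a  *)
(* [groupType].  The two identities coincide by [zero_one] below.             *)
HB.mixin Record isSkewBrace B of Group B := {
  sbzero : B;
  sbopp : B -> B;
  sbadd : B -> B -> B;
  sbaddA : associative sbadd;
  sbadd0 : left_id sbzero sbadd;
  sbaddN : left_inverse sbzero sbopp sbadd;
  sbmulD : forall a b c : B,
    a * sbadd b c = sbadd (sbadd (a * b) (sbopp a)) (a * c)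
}.

#[short(type="skewBraceType")]
HB.structure Definition SkewBrace := {B of isSkewBrace B & Group B}.

Notation "0" := (@sbzero _) : brace_scope.
Notation "x + y" := (@sbadd _ x y) : brace_scope.
Notation "- x" := (@sbopp _ x) : brace_scope.
Notation "x - y" := (@sbadd _ x (@sbopp _ y)) : brace_scope.

Definition is_brace (B : skewBraceType) := commutative (@sbadd B).

Section SkewBraceTheory.
Variable B : skewBraceType.
Implicit Types a b c : B.

Lemma sbaddKN a b : - a + (a + b) = b.
Proof. by rewrite sbaddA sbaddN sbadd0. Qed.

Lemma sbaddI a b c : a + b = a + c -> b = c.
Proof. by move=> e; rewrite -(sbaddKN a b) e sbaddKN. Qed.

Lemma sbaddr0 a : a + 0 = a.
Proof. by apply: (@sbaddI (- a)); rewrite sbaddA sbaddN sbadd0. Qed.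

Lemma sbaddrN a : a - a = 0.
Proof. by apply: (@sbaddI (- a)); rewrite sbaddKN sbaddr0. Qed.

Lemma sboppK a : - - a = a.
Proof. by apply: (@sbaddI (- a)); rewrite sbaddrN sbaddN. Qed.

Lemma sbopp0 : - 0 = 0 :> B.
Proof. by rewrite -{2}(sbaddrN 0) sbadd0. Qed.

Lemma sboppD a b : - (a + b) = - b - a.
Proof.
by apply: (@sbaddI (a + b)); rewrite sbaddrN sbaddA -(sbaddA a) sbaddrN sbaddr0
  sbaddrN.
Qed.

Lemma zero_one : 0 = 1 :> B.
Proof.
have e := sbmulD (1 : B) 0 0.
rewrite !mul1g sbadd0 sbadd0 sbaddr0 in e.
by rewrite -[1]sboppK -e sbopp0.
Qed.

Definition lambda a b := - a + a * b.

Lemma mul_lambda a b : (a * b) = a + lambda a b.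
Proof. by rewrite /lambda sbaddA sbaddrN sbadd0. Qed.

Lemma lambdaD a b c : lambda a (b + c) = lambda a b + lambda a c.
Proof. by rewrite /lambda sbmulD !sbaddA. Qed.

Lemma lambdaM a b c : lambda (a * b) c = lambda a (lambda b c).
Proof.
apply: (@sbaddI (a * b)); rewrite -mul_lambda (mul_lambda a b) -sbaddA.
by rewrite -lambdaD -!mul_lambda mulgA.
Qed.

Lemma lambda1 b : lambda 1 b = b.
Proof. by rewrite /lambda mul1g -zero_one sbopp0 sbadd0. Qed.

Definition add_subgroup (I : set B) :=
  [/\ I 0, forall x y, I x -> I y -> I (x + y) & forall x, I x -> I (- x)].

Definition mul_subgroup (I : set B) :=
  [/\ I 1, forall x y, I x -> I y -> I (x * y) & forall x, I x -> I x^-1].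

Definition is_subbrace (I : set B) := add_subgroup I /\ mul_subgroup I.

Definition is_ideal (I : set B) :=
  [/\ is_subbrace I,
      forall a x, I x -> I (a + x - a),
      forall a x, I x -> I (a * x * a^-1) &
      forall a x, I x -> I (lambda a x)].

End SkewBraceTheory.

Record subbrace (B : skewBraceType) := Subbrace {
  subbrace_set :> set B;
  subbraceP : is_subbrace subbrace_set
}.

Record ideal (B : skewBraceType) := Ideal {
  ideal_set :> set B;
  idealP : is_ideal ideal_set
}.

Definition subbrace_of_ideal (B : skewBraceType) (I : ideal B) : subbrace B :=
  let: And4 I_sub _ _ _ := idealP I in Subbrace I_sub.

Lemma subbrace_of_idealE (B : skewBraceType) (I : ideal B) :
  subbrace_of_ideal I = I :> set B.
Proof. by rewrite /subbrace_of_ideal; case: (idealP I). Qed.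

Section SubbraceType.
Variables (B : skewBraceType) (T : subbrace B).

Local Notation S := (subbrace_set T).

Definition subbrace_type : Type := set_type S.

HB.instance Definition _ := SubChoice.on subbrace_type.

Implicit Types x y z : subbrace_type.

Let mk (a : B) (Sa : S a) : subbrace_type := exist _ a (mem_set Sa).
Let inS x : S (\val x). Proof. exact: set_mem (valP x). Qed.

Let sub0 : S 0. Proof. by have [[]] := subbraceP T. Qed.
Let subD x y : S (\val x + \val y).
Proof. by have [[_ h _] _] := subbraceP T; apply: h; apply: inS. Qed.
Let subN x : S (- \val x).
Proof. by have [[_ _ h] _] := subbraceP T; apply: h; apply: inS. Qed.
Let sub1 : S 1. Proof. by have [_ []] := subbraceP T. Qed.
Let subM x y : S (\val x * \val y).
Proof. by have [_ [_ h _]] := subbraceP T; apply: h; apply: inS. Qed.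
Let subV x : S (\val x)^-1.
Proof. by have [_ [_ _ h]] := subbraceP T; apply: h; apply: inS. Qed.

Definition subbrace_zero := mk sub0.
Definition subbrace_add x y := mk (subD x y).
Definition subbrace_opp x := mk (subN x).
Definition subbrace_one := mk sub1.
Definition subbrace_mul x y := mk (subM x y).
Definition subbrace_inv x := mk (subV x).

Let mulA : associative subbrace_mul.
Proof. by move=> x y z; apply: val_inj; apply: mulgA. Qed.
Let mul1 : left_id subbrace_one subbrace_mul.
Proof. by move=> x; apply: val_inj; apply: mul1g. Qed.
Let mulV : left_inverse subbrace_one subbrace_inv subbrace_mul.
Proof. by move=> x; apply: val_inj; apply: mulVg. Qed.
Let mulr1 : right_id subbrace_one subbrace_mul.
Proof. by move=> x; apply: val_inj; apply: mulg1. Qed.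
Let mulrV : right_inverse subbrace_one subbrace_inv subbrace_mul.
Proof. by move=> x; apply: val_inj; apply: mulgV. Qed.

HB.instance Definition _ :=
  isGroup.Build subbrace_type mulA mul1 mulr1 mulV mulrV.

Let addA : associative subbrace_add.
Proof. by move=> x y z; apply: val_inj; apply: sbaddA. Qed.
Let add0 : left_id subbrace_zero subbrace_add.
Proof. by move=> x; apply: val_inj; apply: sbadd0. Qed.
Let addN : left_inverse subbrace_zero subbrace_opp subbrace_add.
Proof. by move=> x; apply: val_inj; apply: sbaddN. Qed.
Let mulD x y z :
  x * subbrace_add y z =
  subbrace_add (subbrace_add (x * y) (subbrace_opp x)) (x * z).
Proof. by apply: val_inj; apply: sbmulD. Qed.

HB.instance Definition _ :=
  isSkewBrace.Build subbrace_type addA add0 addN mulD.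

End SubbraceType.

Section IdealTrace.
Variables (B : skewBraceType) (S : subbrace B) (J : ideal B).

Definition trace_set : set (subbrace_type S) := [set x | ideal_set J (\val x)].

Lemma trace_ideal : is_ideal trace_set.
Proof.
have [[[J0 JD JN] [J1 JM JV]] JnA JnM JL] := idealP J.
split; first split; first split.
- exact: J0.
- by move=> x y; apply: JD.
- by move=> x; apply: JN.
- split; first exact: J1.
  + by move=> x y; apply: JM.
  + by move=> x; apply: JV.
- by move=> a x; apply: JnA.
- by move=> a x; apply: JnM.
- by move=> a x; apply: JL.
Qed.

Definition trace : ideal (subbrace_type S) := Ideal trace_ideal.

End IdealTrace.

Section QuotientType.
Local Open Scope quotient_scope.
Variables (B : skewBraceType) (I : ideal B).

Local Notation J := (ideal_set I).
Implicit Types x y z : B.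

Definition cong x y : bool := `[< J (- x + y) >].

Let J0 : J 0. Proof. by have [[[]]] := idealP I. Qed.
Let JD x y : J x -> J y -> J (x + y).
Proof. by have [[[_ h _] _] _ _ _] := idealP I; apply: h. Qed.
Let JN x : J x -> J (- x).
Proof. by have [[[_ _ h] _] _ _ _] := idealP I; apply: h. Qed.
Let JM x y : J x -> J y -> J (x * y).
Proof. by have [[_ [_ h _]] _ _ _] := idealP I; apply: h. Qed.
Let JV x : J x -> J x^-1.
Proof. by have [[_ [_ _ h]] _ _ _] := idealP I; apply: h. Qed.
Let JnA x y : J y -> J (x + y - x).
Proof. by have [_ h _ _] := idealP I; apply: h. Qed.
Let JnM x y : J y -> J (x * y * x^-1).
Proof. by have [_ _ h _] := idealP I; apply: h. Qed.
Let JL x y : J y -> J (lambda x y).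
Proof. by have [_ _ _ h] := idealP I; apply: h. Qed.

Lemma congP x y : reflect (J (- x + y)) (cong x y).
Proof. exact: asboolP. Qed.

Lemma congMP x y : reflect (J (x^-1 * y)) (cong x y).
Proof.
apply: (iffP (congP x y)) => h.
  have -> : x^-1 * y = lambda x^-1 (- x + y); last exact: JL.
  apply: (mulgI x); rewrite mulgA mulgV mul1g mul_lambda -lambdaM mulgV.
  by rewrite lambda1 sbaddA sbaddrN sbadd0.
have -> : - x + y = lambda x (x^-1 * y); last exact: JL.
by rewrite /lambda mulgA mulgV mul1g.
Qed.

Let cong_refl : reflexive cong.
Proof. by move=> x; apply/congP; rewrite sbaddN. Qed.

Let cong_sym : symmetric cong.
Proof.
have h x y : cong x y -> cong y x.
  by move=> /congP /JN; rewrite sboppD sboppK => ?; apply/congP.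
by move=> x y; apply/idP/idP; apply: h.
Qed.

Let cong_trans : transitive cong.
Proof.
move=> y x z /congP xy /congP yz; apply/congP.
by have := JD xy yz; rewrite sbaddA -(sbaddA (- x)) sbaddrN sbaddr0.
Qed.

Canonical cong_equiv := EquivRel cong cong_refl cong_sym cong_trans.

Definition quotient_type : Type := {eq_quot cong_equiv}.

HB.instance Definition _ := Choice.on quotient_type.
HB.instance Definition _ := EqQuotient.on quotient_type.

Lemma quotient_piP x y :
  reflect (\pi_quotient_type x = \pi_quotient_type y) (cong x y).
Proof. exact: (@eqquotP _ _ quotient_type x y). Qed.

Definition quotient_zero : quotient_type := \pi 0.
Definition quotient_add := lift_op2 quotient_type (@sbadd B).
Definition quotient_opp := lift_op1 quotient_type (@sbopp B).
Definition quotient_one : quotient_type := \pi 1.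
Definition quotient_mul := lift_op2 quotient_type (fun x y : B => x * y).
Definition quotient_inv := lift_op1 quotient_type (fun x : B => x^-1).

Lemma congD x x' y y' : cong x x' -> cong y y' -> cong (x + y) (x' + y').
Proof.
move=> /congP xx /congP yy; apply/congP.
have := JD (JnA (- y) xx) yy.
by rewrite sboppK sboppD !sbaddA -(sbaddA _ y) sbaddrN sbaddr0.
Qed.

Lemma congN x x' : cong x x' -> cong (- x) (- x').
Proof.
move=> /congP xx; apply/congP.
have := JnA x (JN xx).
by rewrite sboppK sboppD sboppK sbaddA -sbaddA sbaddrN sbaddr0.
Qed.

Lemma congM x x' y y' :
  cong x x' -> cong y y' -> cong (x * y) (x' * y').
Proof.
move=> /congMP xx /congMP yy; apply/congMP.
have := JM (JnM y^-1 xx) yy.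
by rewrite invgK invgM !mulgA mulgK.
Qed.

Lemma congV x x' : cong x x' -> cong x^-1 x'^-1.
Proof.
move=> /congMP xx; apply/congMP.
have := JnM x (JV xx).
by rewrite invgM !mulgA !invgK mulgK.
Qed.

Let reprP x : cong (repr (\pi_quotient_type x)) x.
Proof. by apply/quotient_piP; rewrite reprK. Qed.

Lemma quotient_addE x y :
  quotient_add (\pi x) (\pi y) = \pi_quotient_type (x + y).
Proof. by unlock quotient_add; apply/quotient_piP; apply: congD; apply: reprP. Qed.

Lemma quotient_oppE x : quotient_opp (\pi x) = \pi_quotient_type (- x).
Proof. by unlock quotient_opp; apply/quotient_piP; apply: congN; apply: reprP. Qed.

Lemma quotient_mulE x y :
  quotient_mul (\pi x) (\pi y) = \pi_quotient_type (x * y).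
Proof. by unlock quotient_mul; apply/quotient_piP; apply: congM; apply: reprP. Qed.

Lemma quotient_invE x : quotient_inv (\pi x) = \pi_quotient_type x^-1.
Proof. by unlock quotient_inv; apply/quotient_piP; apply: congV; apply: reprP. Qed.

Let qW (P : quotient_type -> Prop) :
  (forall x, P (\pi x)) -> forall q, P q.
Proof. by move=> h q; rewrite -[q]reprK; apply: h. Qed.

Let qE := (quotient_addE, quotient_oppE, quotient_mulE, quotient_invE).

Let mulA : associative quotient_mul.
Proof.
by elim/qW=> x; elim/qW=> y; elim/qW=> z; rewrite !qE mulgA.
Qed.
Let mul1 : left_id quotient_one quotient_mul.
Proof. by elim/qW=> x; rewrite !qE mul1g. Qed.
Let mulr1 : right_id quotient_one quotient_mul.
Proof. by elim/qW=> x; rewrite !qE mulg1. Qed.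
Let mulV : left_inverse quotient_one quotient_inv quotient_mul.
Proof. by elim/qW=> x; rewrite !qE mulVg. Qed.
Let mulrV : right_inverse quotient_one quotient_inv quotient_mul.
Proof. by elim/qW=> x; rewrite !qE mulgV. Qed.

HB.instance Definition _ :=
  isGroup.Build quotient_type mulA mul1 mulr1 mulV mulrV.

Let addA : associative quotient_add.
Proof.
by elim/qW=> x; elim/qW=> y; elim/qW=> z; rewrite !qE sbaddA.
Qed.
Let add0 : left_id quotient_zero quotient_add.
Proof. by elim/qW=> x; rewrite !qE sbadd0. Qed.
Let addN : left_inverse quotient_zero quotient_opp quotient_add.
Proof. by elim/qW=> x; rewrite !qE sbaddN. Qed.
Let mulD (x y z : quotient_type) :
  x * quotient_add y z =
  quotient_add (quotient_add (x * y) (quotient_opp x)) (x * z).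
Proof.
elim/qW: x => x; elim/qW: y => y; elim/qW: z => z.
by rewrite /mul /= !qE sbmulD.
Qed.

HB.instance Definition _ :=
  isSkewBrace.Build quotient_type addA add0 addN mulD.

Lemma piD x y :
  \pi_quotient_type (x + y) = \pi_quotient_type x + \pi_quotient_type y.
Proof. by rewrite -quotient_addE. Qed.

Lemma piN x : \pi_quotient_type (- x) = - \pi_quotient_type x.
Proof. by rewrite -quotient_oppE. Qed.

Lemma piM x y :
  \pi_quotient_type (x * y) = \pi_quotient_type x * \pi_quotient_type y.
Proof. by rewrite -quotient_mulE. Qed.

End QuotientType.

(* I/(J \cap I); used only for [J] contained in [I], where it is I/J.         *)
Definition factor (B : skewBraceType) (I J : ideal B) : skewBraceType :=
  quotient_type (trace (subbrace_of_ideal I) J).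

Definition abelian (A : skewBraceType) :=
  forall a b : A, [/\ a * b = b * a, b * a = a + b & a + b = b + a].

Definition soluble (B : skewBraceType) :=
  exists (n : nat) (I : nat -> ideal B),
    [/\ I 0%N = [set 0] :> set B,
        I n = [set: B] :> set B &
        forall j, (j < n)%N ->
          I j `<=` I j.+1 /\ abelian (factor (I j.+1) (I j))].

Definition i_noetherian (B : skewBraceType) :=
  forall I : nat -> ideal B, (forall n, I n `<=` I n.+1) ->
    exists m, forall n, (m <= n)%N -> I n = I m :> set B.

Definition finitely_generated (B : skewBraceType) :=
  exists X : set B, finite_set X /\
    forall S : subbrace B, X `<=` S -> S = [set: B] :> set B.

(* Main.v *)
Require Import Defs.
From HB Require Import structures.
From mathcomp Require Import all_boot.
From mathcomp Require Import boolp classical_sets functions cardinality.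

Set Implicit Arguments.
Unset Strict Implicit.
Unset Printing Implicit Defensive.

Local Open Scope classical_set_scope.
Local Open Scope group_scope.
Local Open Scope brace_scope.
Local Open Scope quotient_scope.

(** Descend along the abelian series, from [B] to [0], keeping a finite set [X]
    such that every subbrace [S] containing [X] satisfies [S + I_j = B].  To
    pass from [I = I_(j+1)] to [J = I_j], add to [X] finitely many generators
    of the ideal [I], which exist by the maximal condition.  Now
    [I \cap (S + J)] is an ideal of [B]: modulo [J] it is preserved by [S],
    while [I] acts trivially on it because [I/J] is abelian, and [B = S + I].
    It contains the generators of [I], so [I] is contained in [S + J] and
    [S + J = S + I = B]. *)

Section GeneratedIdeal.
Variable B : skewBraceType.
Implicit Types Y : set B.

Definition gen_ideal_set Y : set B :=
  [set x | forall K : ideal B, Y `<=` K -> ideal_set K x].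

Lemma gen_ideal_is_ideal Y : is_ideal (gen_ideal_set Y).
Proof.
split; first split; first split.
- by move=> K _; have [[[]]] := idealP K.
- move=> x y hx hy K YK; have [[[_ h _] _] _ _ _] := idealP K.
  by apply: h; [apply: hx | apply: hy].
- move=> x hx K YK; have [[[_ _ h] _] _ _ _] := idealP K.
  exact/h/hx.
- split.
  + by move=> K _; have [[_ []]] := idealP K.
  + move=> x y hx hy K YK; have [[_ [_ h _]] _ _ _] := idealP K.
    by apply: h; [apply: hx | apply: hy].
  + move=> x hx K YK; have [[_ [_ _ h]] _ _ _] := idealP K.
    exact/h/hx.
- by move=> a x hx K YK; have [_ h _ _] := idealP K; apply/h/hx.
- by move=> a x hx K YK; have [_ _ h _] := idealP K; apply/h/hx.
- by move=> a x hx K YK; have [_ _ _ h] := idealP K; apply/h/hx.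
Qed.

Definition gen_ideal Y : ideal B := Ideal (gen_ideal_is_ideal Y).

Lemma sub_gen_ideal Y : Y `<=` gen_ideal Y.
Proof. by move=> x Yx K; apply. Qed.

Lemma gen_idealS Y Z : Y `<=` Z -> gen_ideal Y `<=` gen_ideal Z.
Proof. by move=> YZ x hx K ZK; apply: hx => y /YZ /ZK. Qed.

(** If no finite subset generated [I], adjoining again and again a point of [I] not yet generated
    would give an ascending chain of ideals that never stabilises. *)
Lemma i_noetherian_ideal_fg (I : ideal B) : i_noetherian B ->
  exists Y : set B, [/\ finite_set Y, Y `<=` I &
    forall K : ideal B, Y `<=` K -> I `<=` K].
Proof.
move=> noeth; apply: contrapT => nfg.
(* The conditions on [Y] stand under the quantifier so that [choice] yields a total [f]; 0 is a
   dummy value where they fail. *)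
have missed Y : exists y, finite_set Y -> Y `<=` I ->
    ideal_set I y /\ ~ gen_ideal_set Y y.
  have [finY|] := pselect (finite_set Y); last by exists 0.
  have [YI|] := pselect (Y `<=` I); last by exists 0.
  apply: contrapT => noy; apply: nfg; exists Y; split=> // K YK y Iy.
  apply: contrapT => nKy; apply: noy; exists y => _ _; split=> // genYy.
  exact/nKy/genYy.
have [f fP] := choice missed.
pose Y n := iter n (fun Z => Z `|` [set f Z]) set0.
have YP n : finite_set (Y n) /\ Y n `<=` I.
  elim: n => [|n [finY YI]]; first by split; [exact: finite_set0 | move=> ?].
  split; first by rewrite finite_setU; split=> //; apply: finite_set1.
  by move=> y [/YI|->] //; have [] := fP _ finY YI.
have [|m stable] := noeth (fun n => gen_ideal (Y n)).
  by move=> n; apply: gen_idealS => y; left.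
have [finY YI] := YP m; have [_] := fP _ finY YI; apply.
suff : ideal_set (gen_ideal (Y m.+1)) (f (Y m)) by rewrite stable.
by apply: sub_gen_ideal; right.
Qed.

End GeneratedIdeal.

Section AbelianFactor.
Variables (B : skewBraceType) (I J : ideal B).
Hypothesis abIJ : abelian (factor I J).

Local Notation q := (\pi_(quotient_type J)).

Lemma pi_inv (x y : B) : q x = q y -> q x^-1 = q y^-1.
Proof. by move=> e; rewrite -!quotient_invE e. Qed.

(** Moves commutation from [factor I J], a quotient of the subbrace type of [I], to classes in B/J,
    where elements of [I] can be combined with arbitrary elements of [B]. *)
Lemma pi_abelian (u v : B) : ideal_set I u -> ideal_set I v ->
  [/\ q (u * v) = q (v * u), q (u * v) = q (u + v) & q (u + v) = q (v + u)].
Proof.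
rewrite -!(subbrace_of_idealE I) => Iu Iv.
pose u' : subbrace_type (subbrace_of_ideal I) := exist _ u (mem_set Iu).
pose v' : subbrace_type (subbrace_of_ideal I) := exist _ v (mem_set Iv).
have lift (x y : subbrace_type (subbrace_of_ideal I)) :
    \pi_(quotient_type (trace (subbrace_of_ideal I) J)) x =
    \pi_(quotient_type (trace (subbrace_of_ideal I) J)) y ->
    q (\val x) = q (\val y).
  by move=> /quotient_piP/congP h; apply/quotient_piP/congP.
have [mC mD aC] := abIJ (\pi u') (\pi v').
split.
- by apply: (lift (u' * v') (v' * u')); rewrite !piM.
- by apply: (lift (u' * v') (u' + v')); rewrite piM piD mC mD.
- by apply: (lift (u' + v') (v' + u')); rewrite !piD.
Qed.

Variable S : subbrace B.
Hypothesis SI : forall b, exists2 s, subbrace_set S s & ideal_set I (- s + b).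

(** This is the intersection of [I] with S + J; lying in S + J is expressed as having the class of
    an element of [S]. *)
Definition sub_trace : set B :=
  [set x | ideal_set I x /\ exists2 s, subbrace_set S s & q x = q s].

Lemma sub_trace_ideal : is_ideal sub_trace.
Proof.
have [[[I0 ID IN] [I1 IM IV]] InA InM IL] := idealP I.
have [[S0 SD SN] [S1 SM SV]] := subbraceP S.
split; first split; first split.
- by split=> //; exists 0.
- move=> x y [Ix [s Ss xs]] [Iy [t St yt]]; split; first exact: ID.
  by exists (s + t); [apply: SD | rewrite !piD xs yt].
- move=> x [Ix [s Ss xs]]; split; first exact: IN.
  by exists (- s); [apply: SN | rewrite !piN xs].
- split.
  + by split=> //; exists 1.
  + move=> x y [Ix [s Ss xs]] [Iy [t St yt]]; split; first exact: IM.
    by exists (s * t); [apply: SM | rewrite !piM xs yt].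
  + move=> x [Ix [s Ss xs]]; split; first exact: IV.
    by exists s^-1; [apply: SV | apply: pi_inv].
- move=> b x [Ix [t St xt]]; split; first exact: InA.
  (* With b = s + u, conjugation by [u] fixes [x] modulo [J], so [b] acts on the class of [x] as [s]
     acts on that of [t]. *)
  have [s Ss Iu] := SI b; exists (s + t - s); first by apply/SD/SN/Ss/SD.
  set u := - s + b in Iu.
  have -> : b = s + u by rewrite sbaddA sbaddrN sbadd0.
  clearbody u.
  have [_ _ aC] := pi_abelian Iu Ix.
  rewrite sboppD !sbaddA -(sbaddA s) 3!piD aC piD !sbaddA -!piD -!sbaddA.
  by rewrite (sbaddA u) sbaddrN sbadd0 !piD xt.
- move=> b x [Ix [t St xt]]; split; first exact: InM.
  (* Additive and multiplicative cosets of an ideal coincide, so the same [s] gives b = s * v with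
     [v] in [I]. *)
  have [s Ss /congP/congMP Iv] := SI b.
  exists (s * t * s^-1); first by apply/SM/SV/Ss/SM.
  set v := s^-1 * b in Iv.
  have -> : b = s * v by rewrite mulgA mulgV mul1g.
  clearbody v.
  have [mC _ _] := pi_abelian Iv Ix.
  rewrite invgM !mulgA -(mulgA s) 3![in LHS]piM mC piM !mulgA -!piM -!mulgA.
  by rewrite (mulgA v) mulgV mul1g !piM xt.
- move=> b x [Ix [t St xt]]; split; first exact: IL.
  have [s Ss /congP/congMP Iv] := SI b.
  exists (lambda s t); first by apply/SD/SM => //; apply: SN.
  set v := s^-1 * b in Iv.
  have -> : b = s * v by rewrite mulgA mulgV mul1g.
  clearbody v.
  have [_ mD _] := pi_abelian Iv Ix.
  (* Product and sum agree on I/J, so [lambda v] is trivial there. *)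
  have lx : q (lambda v x) = q x by rewrite /lambda piD mD -piD sbaddKN.
  by rewrite lambdaM /lambda piD piM lx xt -piM -piD.
Qed.

Lemma sum_abelian_factor (Y : set B) :
    (forall K : ideal B, Y `<=` K -> I `<=` K) -> Y `<=` I -> Y `<=` S ->
  forall b, exists2 s, subbrace_set S s & ideal_set J (- s + b).
Proof.
move=> genI YI YS b; have [s Ss Iu] := SI b.
have YK : Y `<=` Ideal sub_trace_ideal.
  by move=> y Yy; split; [apply: YI | exists y => //; apply: YS].
(* The remainder - s + b lies in [I], hence in S + J; its representative [t] corrects [s] to s +
   t. *)
have [_ [t St /esym /quotient_piP /congP Jtu]] := genI _ YK _ Iu.
have [[_ SD _] _] := subbraceP S.
by exists (s + t); [apply: SD | rewrite sboppD -sbaddA].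
Qed.

End AbelianFactor.

Theorem theorem3p2 (B : skewBraceType) :
  is_brace B -> i_noetherian B -> soluble B -> finitely_generated B.
Proof.
move=> _ noeth [n [I [I0 In Iab]]].
(* [k] counts the steps down from I_n = B; [X] is chosen before [S], so one finite set serves all
   subbraces. *)
have descent k : (k <= n)%N -> exists X : set B, finite_set X /\
    forall S : subbrace B, X `<=` S ->
      forall b, exists2 s, subbrace_set S s & ideal_set (I (n - k)%N) (- s + b).
  elim: k => [_|k IHk kn].
    exists set0; split=> [|S _ b]; first exact: finite_set0.
    have [[S0 _ _] _] := subbraceP S.
    by exists 0 => //; rewrite subn0 In.
  have [X [finX XP]] := IHk (ltnW kn).
  have [Y [finY YI YP]] := i_noetherian_ideal_fg (I (n - k)%N) noeth.
  exists (X `|` Y); split=> [|S]; first by rewrite finite_setU.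
  rewrite subUset => -[XS YS].
  have ltn : (n - k.+1 < n)%N by rewrite -subSn // subSS leq_subr.
  (* The successor of n - k.+1 is n - k because k < n. *)
  have := Iab _ ltn; rewrite -subSn // subSS => -[_ abIJ].
  exact: (sum_abelian_factor abIJ (XP _ XS) YP YI YS).
have [X [finX XP]] := descent n (leqnn n).
exists X; split=> // S XS; apply/seteqP; split=> // b _.
have [s Ss] := XP _ XS b; rewrite subnn I0 => /= sb0.
suff -> : b = s by [].
by rewrite -[s]sbaddr0 -sb0 sbaddA sbaddrN sbadd0.
Qed.
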